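(* There exists a setting (with pairwise distinct budgets) such that, in the game in which every player's budget-bid is fixed to his true budget ($g_i=B_i$) and each player's strategy is only his value-bid $b_i\ge 0$, no pure Nash equilibrium exists, both under the BCB mechanism and under the BCBO mechanism.
   Context: Setting: there are $k\ge 1$ slots with public click-through rates $\theta_1>\theta_2>\dots>\theta_k>0$, and $n\ge k$ players. Player $i$ has a private value per click $v_i\ge 0$ and a budget $B_i>0$; the budgets $B_1,\dots,B_n$ are pairwise distinct. A setting consists of $k,n,(\theta_j),(v_i),(B_i)$ together with a fixed strict priority order on the players used to break all ties. Each player $i$ submits a value-bid $b_i\ge 0$ and a budget-bid $g_i\ge 0$; a mechanism outputs an injective partial slot assignment (assigned player $i$ gets slot $s(i)\in\{1,\dots,k\}$) and a price per click $p(i)\ge0$ for each assigned player; unassigned players pay nothing. The utility of player $i$ is $u_i=0$ if $i$ is unassigned, $u_i=\theta_{s(i)}(v_i-p(i))$ if $i$ is assigned and $\theta_{s(i)}p(i)\le B_i$, and $u_i=-\infty$ if $i$ is assigned and $\theta_{s(i)}p(i)>B_i$. A Nash equilibrium of the fixed-budget-bid game is a profile of value-bids such that no player can strictly increase his utility by changing only his own value-bid. BCB: order the players by decreasing value-bid (ties broken by the priority order); each player's price per click is the value-bid of the player immediately after him in this order (0 for the last player). Then process the players in this order; each player $i$ is assigned the highest-CTR slot $s$ not yet assigned such that $\theta_s b_i\le g_i$, and pays his price per click; if no unassigned slot satisfies this, he is left unassigned and pays nothing. BCBO: for $s=1,2,\dots,k$ in this order, among the players not yet assigned compute the offers $o_i^s=\min\{b_i,\,g_i/\theta_s\}$;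 slot $s$ is awarded to the not-yet-assigned player with the largest offer (ties broken by the priority order), who pays per click the second largest offer $o^s$ among the not-yet-assigned players (0 if there is no other such player). *)

(* Defs.v *)
From Stdlib Require Import Reals Lra List Arith Bool.
Import ListNotations.
Open Scope R_scope.

(** Players are 0, ..., n-1; slots are 1, ..., k.  The priority order is
    given by a rank function [prio] (smaller rank = higher priority),
    required to be injective on the players. *)
Record setting := mkSetting {
  k : nat;
  n : nat;
  theta : nat -> R;   (* click-through rate of slot j, for 1 <= j <= k *)
  v : nat -> R;       (* value per click of player i *)
  B : nat -> R;
  prio : nat -> nat
}.

Definition well_formed (S : setting) : Prop :=
  (1 <= k S)%nat /\ (k S <= n S)%nat /\
  (forall j, (1 <= j)%nat -> (j < k S)%nat -> theta S j > theta S (Datatypes.S j)) /\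
  theta S (k S) > 0 /\
  (forall i, (i < n S)%nat -> 0 <= v S i) /\
  (forall i, (i < n S)%nat -> 0 < B S i) /\
  (forall i j, (i < n S)%nat -> (j < n S)%nat -> i <> j -> B S i <> B S j) /\
  (forall i j, (i < n S)%nat -> (j < n S)%nat -> prio S i = prio S j -> i = j).

Definition before (S : setting) (f : nat -> R) (x y : nat) : bool :=
  if Rlt_dec (f y) (f x) then true
  else if Req_EM_T (f x) (f y) then Nat.ltb (prio S x) (prio S y)
  else false.

Fixpoint insert_by (S : setting) (f : nat -> R) (x : nat) (l : list nat)
  : list nat :=
  match l with
  | [] => [x]
  | y :: l' => if before S f x y then x :: l else y :: insert_by S f x l'
  end.

Definition sort_by (S : setting) (f : nat -> R) (l : list nat) : list nat :=
  fold_right (insert_by S f) [] l.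

Definition players (S : setting) : list nat := seq 0 (n S).
Definition slots (S : setting) : list nat := seq 1 (k S).

(** An outcome: list of (player, slot, price per click) for assigned players. *)
Definition outcome := list (nat * nat * R).

Fixpoint bcb_go (S : setting) (b g : nat -> R) (taken : list nat)
  (l : list nat) : outcome :=
  match l with
  | [] => []
  | i :: rest =>
      let price := match rest with [] => 0 | j :: _ => b j end in
      match find (fun s => negb (existsb (Nat.eqb s) taken)
                           && (if Rle_dec (theta S s * b i) (g i)
                               then true else false)) (slots S) with
      | Some s => (i, s, price) :: bcb_go S b g (s :: taken) rest
      | None => bcb_go S b g taken rest
      end
  end.

Definition BCB (S : setting) (b g : nat -> R) : outcome :=
  bcb_go S b g [] (sort_by S b (players S)).

Definition offer (S : setting) (b g : nat -> R) (s i : nat) : R :=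
  Rmin (b i) (g i / theta S s).

Fixpoint bcbo_go (S : setting) (b g : nat -> R) (sl : list nat)
  (remaining : list nat) : outcome :=
  match sl with
  | [] => []
  | s :: ss =>
      match sort_by S (offer S b g s) remaining with
      | [] => []
      | w :: rest =>
          let price := match rest with [] => 0 | j :: _ => offer S b g s j end in
          (w, s, price) :: bcbo_go S b g ss rest
      end
  end.

Definition BCBO (S : setting) (b g : nat -> R) : outcome :=
  bcbo_go S b g (slots S) (players S).

Inductive eR := Fin (r : R) | NegInf.

Definition eR_lt (x y : eR) : Prop :=
  match x, y with
  | NegInf, Fin _ => True
  | Fin a, Fin c => a < c
  | _, _ => False
  end.

Definition utility (S : setting) (o : outcome) (i : nat) : eR :=
  match find (fun e => Nat.eqb (fst (fst e)) i) o with
  | None => Fin 0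
  | Some (_, s, p) =>
      if Rle_dec (theta S s * p) (B S i) then Fin (theta S s * (v S i - p))
      else NegInf
  end.

Definition mechanism := setting -> (nat -> R) -> (nat -> R) -> outcome.

Definition update (b : nat -> R) (i : nat) (x : R) : nat -> R :=
  fun j => if Nat.eqb j i then x else b j.

Definition is_NE (M : mechanism) (S : setting) (b : nat -> R) : Prop :=
  (forall i, (i < n S)%nat -> 0 <= b i) /\
  forall i, (i < n S)%nat -> forall x, 0 <= x ->
    ~ eR_lt (utility S (M S b (B S)) i)
            (utility S (M S (update b i x) (B S)) i).

(* Main.v *)
Require Import Defs.
From Stdlib Require Import Reals.
From Stdlib Require Import Lra Lia List Arith Permutation Sorted Classical.
Import ListNotations.
Open Scope R_scope.

(** The setting has five slots, three "rich" players (value 10, budgets that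
    never bind) and two "poor" players (value 12, budgets too small to pay 8
    per click for one of the two top slots).  Both mechanisms share two
    features: a player bidding [beta] gets one of the slots [1..j] at a price
    at most [beta] unless [j] others bid at least [beta] and can afford it at
    slot [j]; and of two assigned players, one pays at least the bid of the
    other (up to a budget cap).  Let [z] hold slot 5, which must be free.
    If [z] is poor, everybody else bids at least 6, since otherwise [z] would
    take slot 4; so the holder of slot 3 or of slot 4 pays at least 6 and must
    be the other poor player, who would rather bid 11/2, just above [z].
    If [z] is rich, the two other rich players bid at least 8, since otherwise
    [z] would take slot 2; one of them then pays so much that he prefers
    bidding 15/2, which still wins one of the two top slots. *)

(** * Insertion sort by [before] *)

Section Sorting.

Variables (S : setting) (f : nat -> R).

Lemma before_true_le x y : before S f x y = true -> f y <= f x.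
Proof.
unfold before; destruct (Rlt_dec (f y) (f x)); [lra|].
destruct (Req_EM_T (f x) (f y)); [lra|discriminate].
Qed.

Lemma before_false_le x y : before S f x y = false -> f x <= f y.
Proof. unfold before; destruct (Rlt_dec (f y) (f x)); [discriminate|lra]. Qed.

Lemma insert_by_perm x l : Permutation (insert_by S f x l) (x :: l).
Proof.
induction l as [|y l IH]; simpl; [reflexivity|].
destruct (before S f x y); [reflexivity|].
now rewrite IH, perm_swap.
Qed.

Lemma sort_by_perm l : Permutation (sort_by S f l) l.
Proof.
induction l as [|x l IH]; simpl; [reflexivity|].
now rewrite insert_by_perm, IH.
Qed.

Lemma insert_by_sorted x l :
  StronglySorted (fun x y => f y <= f x) l ->
  StronglySorted (fun x y => f y <= f x) (insert_by S f x l).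
Proof.
induction 1 as [|y l Hl IH Hy]; simpl; [now repeat constructor|].
destruct (before S f x y) eqn:E.
- apply before_true_le in E.
  constructor; [now constructor|constructor; [exact E|]].
  rewrite Forall_forall in Hy |- *; intros u Hu; specialize (Hy u Hu); lra.
- apply before_false_le in E.
  constructor; [exact IH|].
  rewrite Forall_forall in Hy |- *; intros u Hu.
  apply (Permutation_in _ (insert_by_perm x l)) in Hu.
  destruct Hu as [<-|Hu]; auto.
Qed.

Lemma sort_by_sorted l : StronglySorted (fun x y => f y <= f x) (sort_by S f l).
Proof. induction l; simpl; [constructor|now apply insert_by_sorted]. Qed.

End Sorting.

(** * Searching, division, counting, and monotone click-through rates *)

Lemma find_seq_le f a m s s' :
  find f (seq a m) = Some s' -> In s (seq a m) -> f s = true -> (s' <= s)%nat.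
Proof.
revert a; induction m as [|m IH]; intros a; simpl; [discriminate|].
destruct (f a) eqn:E.
- intros [= <-] [->|H] _; [lia|apply in_seq in H; lia].
- intros H [->|H'] Hs; [congruence|eauto].
Qed.

Lemma le_div_r a c x : 0 < c -> (a <= x / c <-> c * a <= x).
Proof.
intros Hc; replace x with (c * (x / c)) at 2 by (field; lra).
split; intros H; [apply Rmult_le_compat_l|apply Rmult_le_reg_l in H]; lra.
Qed.

(** A relation spares choosing a function from [X] to [Y]. Each [y] serves at most one [x], so it
    can be deleted from [m] once used. *)
Lemma pigeonhole {X Y} (P : X -> Y -> Prop) (l : list X) (m : list Y) :
  NoDup l ->
  (forall x, In x l -> exists y, In y m /\ P x y) ->
  (forall x x' y, P x y -> P x' y -> x = x') ->
  (length l <= length m)%nat.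
Proof.
intros Hl; revert m; induction Hl as [|x l Hx Hl IH]; intros m Hm Hinj; simpl; [lia|].
destruct (Hm x (or_introl eq_refl)) as [y [Hy Pxy]].
destruct (in_split _ _ Hy) as [m1 [m2 ->]].
specialize (IH (m1 ++ m2)).
rewrite !length_app in *; simpl.
enough (length l <= length m1 + length m2)%nat by lia.
apply IH; [|exact Hinj].
intros x' Hx'.
destruct (Hm x' (or_intror Hx')) as [y' [Hy' Pxy']].
exists y'; split; [|exact Pxy'].
rewrite in_app_iff in *; simpl in Hy'.
destruct Hy' as [|[<-|]]; auto.
now destruct Hx; rewrite (Hinj x x' y).
Qed.

Lemma theta_pos_decreasing S : well_formed S -> forall s t,
  (1 <= s)%nat -> (s <= t)%nat -> (t <= k S)%nat -> 0 < theta S t <= theta S s.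
Proof.
intros (_ & _ & Hdec & Hk & _).
assert (H : forall s t, (1 <= s)%nat -> (s <= t)%nat -> (t <= k S)%nat ->
                        theta S t <= theta S s).
{ intros s t Hs Hst; induction Hst as [|t Hst IH]; intros Ht; [lra|].
  specialize (IH ltac:(lia)); specialize (Hdec t ltac:(lia) ltac:(lia)); lra. }
intros s t Hs Hst Ht; split; [|auto].
specialize (H t (k S) ltac:(lia) Ht ltac:(lia)); lra.
Qed.

(** The properties on which the equilibrium argument rests, chosen so that both mechanisms share
    them. In [reg_block], a bid affordable at slot 1 is affordable everywhere, so the budget keeps
    [i] out of no slot. [reg_price] is a disjunction because in BCB either player may come first in
    the bid order; its [Rmin] is an offer of BCBO. *)
Record regular (S : setting) (b : nat -> R) (o : outcome) : Prop := {
  reg_players : NoDup (map (fun e => fst (fst e)) o);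
  reg_slots : NoDup (map (fun e => snd (fst e)) o);
  reg_entry : forall i s p, In (i, s, p) o ->
    (i < n S)%nat /\ (1 <= s <= k S)%nat /\ 0 <= p <= b i;
  reg_block : forall i s, (i < n S)%nat -> (1 <= s <= k S)%nat ->
    theta S 1 * b i <= B S i ->
    (exists s' p, In (i, s', p) o /\ (s' <= s)%nat) \/
    (exists w p, In (w, s, p) o /\ w <> i /\ b i <= b w /\ theta S s * b i <= B S w);
  reg_price : forall i s p q t r, In (i, s, p) o -> In (q, t, r) o -> (s < t)%nat ->
    Rmin (b q) (B S q / theta S s) <= p \/ b i <= r
}.

(** The price rule of both mechanisms, with default 0 when nobody follows; naming it lets the same
    bounds on sorted lists serve both. *)
Definition head_value (f : nat -> R) (l : list nat) : R :=
  match l with [] => 0 | j :: _ => f j end.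

Lemma head_value_bounds f i l : 0 <= f i ->
  (forall j, In j l -> 0 <= f j) -> Forall (fun j => f j <= f i) l ->
  0 <= head_value f l <= f i.
Proof.
intros Hi Hl Hs; destruct Hs as [|j l Hj]; simpl; [lra|].
specialize (Hl j (or_introl eq_refl)); lra.
Qed.

Lemma head_value_ge f l q :
  StronglySorted (fun x y => f y <= f x) l -> In q l -> f q <= head_value f l.
Proof.
intros Hs Hq; destruct Hs as [|j l _ Hj]; [easy|]; simpl.
destruct Hq as [<-|Hq]; [lra|].
now rewrite Forall_forall in Hj; apply Hj.
Qed.

(** * BCB outcomes are regular *)

Section Mechanisms.

Variables (S : setting) (b : nat -> R).
Hypotheses (wf : well_formed S) (b_ge0 : forall i, (i < n S)%nat -> 0 <= b i).

Definition available (t : list nat) (i s : nat) : bool :=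
  (negb (existsb (Nat.eqb s) t)
   && (if Rle_dec (theta S s * b i) (B S i) then true else false))%bool.

Lemma available_spec t i s :
  available t i s = true <-> ~ In s t /\ theta S s * b i <= B S i.
Proof.
unfold available; rewrite Bool.andb_true_iff, Bool.negb_true_iff.
rewrite <- Bool.not_true_iff_false, existsb_exists.
destruct (Rle_dec (theta S s * b i) (B S i)) as [H|H].
- split; intros [Ht _]; (split; [|easy]).
  + intros Hs; apply Ht; exists s; split; [easy|apply Nat.eqb_refl].
  + now intros [u [Hu ->%Nat.eqb_eq]].
- split; intros [_ ?]; easy.
Qed.

Lemma bcb_go_entry l : StronglySorted (fun x y => b y <= b x) l ->
  (forall i, In i l -> (i < n S)%nat) -> forall t i s p,
  In (i, s, p) (bcb_go S b (B S) t l) ->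
  In i l /\ ~ In s t /\ (1 <= s <= k S)%nat /\ 0 <= p <= b i.
Proof.
induction 1 as [|h l Hl IH Hh]; intros Hn t i s p; simpl; [easy|].
specialize (IH (fun i Hi => Hn i (or_intror Hi))).
fold (available t h); fold (head_value b l).
destruct (find _ _) as [s'|] eqn:E.
- apply find_some in E; destruct E as [Es' Ht]; apply available_spec in Ht.
  apply in_seq in Es'.
  intros [[= <- <- <-]|H].
  + split; [now left|split; [easy|split; [lia|]]].
    apply head_value_bounds; auto; intros; apply b_ge0; apply Hn; simpl; auto.
  + apply IH in H; simpl in H; tauto.
- intros H; apply IH in H; tauto.
Qed.

Lemma bcb_go_NoDup l : StronglySorted (fun x y => b y <= b x) l ->
  (forall i, In i l -> (i < n S)%nat) -> NoDup l -> forall t,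
  NoDup (map (fun e => fst (fst e)) (bcb_go S b (B S) t l)) /\
  NoDup (map (fun e => snd (fst e)) (bcb_go S b (B S) t l)).
Proof.
induction 1 as [|h l Hl IH Hh]; intros Hn Hd t; simpl; [split; constructor|].
inversion_clear Hd as [|? ? Hhl Hd'].
assert (Hn' : forall i, In i l -> (i < n S)%nat) by (intros; apply Hn; now right).
specialize (IH Hn' Hd').
fold (available t h).
destruct (find _ _) as [s'|] eqn:E; [|auto].
simpl; split; constructor; try apply IH; rewrite in_map_iff;
  intros [[[i s] p] [Heq H]]; simpl in Heq; subst;
  apply (bcb_go_entry _ Hl Hn') in H; simpl in H; tauto.
Qed.

(** If [s] is still free at the turn of [i], the search stops at [s] or earlier. If [s] is gone by
    then, its holder precedes [i] in the order, so he bids at least [b i] and can afford his own bid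
    at [s]. *)
Lemma bcb_go_block l : StronglySorted (fun x y => b y <= b x) l ->
  NoDup l -> forall t i s, In i l -> (1 <= s <= k S)%nat -> ~ In s t ->
  theta S s * b i <= B S i ->
  (exists s' p, In (i, s', p) (bcb_go S b (B S) t l) /\ (s' <= s)%nat) \/
  (exists w p, In (w, s, p) (bcb_go S b (B S) t l) /\
     w <> i /\ b i <= b w /\ theta S s * b i <= B S w).
Proof.
induction 1 as [|h l Hl IH Hh]; intros Hd t i s; simpl; [easy|].
inversion_clear Hd as [|? ? Hhl Hd'].
fold (available t h); fold (head_value b l).
intros Hi Hs Ht Haff.
assert (Hseq : In s (slots S)) by (apply in_seq; lia).
destruct Hi as [<-|Hi].
- left.
  assert (Hav : available t h s = true) by now apply available_spec.
  destruct (find _ _) as [s'|] eqn:E.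
  + exists s', (head_value b l); split; [now left|].
    exact (find_seq_le _ _ _ _ _ E Hseq Hav).
  + apply find_none with (x := s) in E; [congruence|exact Hseq].
- destruct (find _ _) as [s'|] eqn:E; [|now apply IH].
  apply find_some in E; destruct E as [_ Ht']; apply available_spec in Ht'.
  destruct (Nat.eq_dec s s') as [<-|Hss].
  + right; exists h, (head_value b l).
    rewrite Forall_forall in Hh; specialize (Hh i Hi).
    repeat split; [now left|congruence|lra|].
    pose proof (theta_pos_decreasing S wf s s ltac:(lia) ltac:(lia) ltac:(lia)).
    destruct Ht' as [_ Ht']; nra.
  + destruct (IH Hd' (s' :: t) i s) as [(s'' & p & H1 & H2)|(w & p & H1 & H2)];
      auto; simpl; [intuition congruence|left; eauto|right; eauto].
Qed.

(** Whichever of the two players comes first pays the bid of his successor, which dominates every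
    later bid. [s <> u] excludes comparing an entry with itself. *)
Lemma bcb_go_price l : StronglySorted (fun x y => b y <= b x) l ->
  (forall i, In i l -> (i < n S)%nat) ->
  forall t i s p q u r,
  In (i, s, p) (bcb_go S b (B S) t l) -> In (q, u, r) (bcb_go S b (B S) t l) ->
  s <> u -> b q <= p \/ b i <= r.
Proof.
induction 1 as [|h l Hl IH Hh]; intros Hn t i s p q u r; simpl; [easy|].
assert (Hn' : forall i, In i l -> (i < n S)%nat) by (intros; apply Hn; now right).
specialize (IH Hn').
fold (available t h); fold (head_value b l).
destruct (find _ _) as [s'|] eqn:E; [|now apply IH].
intros [[= <- <- <-]|H1] [[= <- <- <-]|H2] Hsu.
- easy.
- left; apply bcb_go_entry in H2; auto; now apply head_value_ge.
- right; apply bcb_go_entry in H1; auto; now apply head_value_ge.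
- eauto.
Qed.

Lemma in_players i : In i (players S) <-> (i < n S)%nat.
Proof. unfold players; rewrite in_seq; lia. Qed.

Lemma bcb_regular : regular S b (BCB S b (B S)).
Proof.
unfold BCB; set (l := sort_by S b (players S)).
pose proof (sort_by_perm S b (players S)) as Hp; fold l in Hp.
pose proof (sort_by_sorted S b (players S)) as Hs; fold l in Hs.
assert (Hin : forall i, In i l <-> (i < n S)%nat).
{ intros i; rewrite <- in_players; split; apply Permutation_in; easy. }
assert (Hd : NoDup l) by (rewrite Hp; apply seq_NoDup).
assert (Hn : forall i, In i l -> (i < n S)%nat) by apply Hin.
destruct (bcb_go_NoDup l Hs Hn Hd []) as [H1 H2].
constructor; [exact H1|exact H2|..].
- intros i s p H; apply bcb_go_entry in H; auto.
  rewrite Hin in H; tauto.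
- intros i s Hi Hs' Ha; apply bcb_go_block; auto; [now apply Hin|].
  pose proof (theta_pos_decreasing S wf 1 s ltac:(lia) ltac:(lia) ltac:(lia)).
  specialize (b_ge0 i Hi); nra.
- intros i s p q u r H3 H4 Hsu.
  destruct (bcb_go_price l Hs Hn [] i s p q u r H3 H4 ltac:(lia)) as [H|H]; auto.
  left; eapply Rle_trans; [apply Rmin_l|exact H].
Qed.

(** * BCBO outcomes are regular *)

Lemma bcbo_go_cases s sl rem : NoDup rem -> rem <> [] ->
  exists w rest,
    bcbo_go S b (B S) (s :: sl) rem =
      (w, s, head_value (offer S b (B S) s) rest) :: bcbo_go S b (B S) sl rest /\
    StronglySorted (fun x y => offer S b (B S) s y <= offer S b (B S) s x) (w :: rest) /\
    NoDup (w :: rest) /\ (forall i, In i rem <-> i = w \/ In i rest).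
Proof.
intros Hd Hne; simpl.
pose proof (sort_by_perm S (offer S b (B S) s) rem) as Hp.
pose proof (sort_by_sorted S (offer S b (B S) s) rem) as Hs.
destruct (sort_by _ _ _) as [|w rest].
- now apply Permutation_nil in Hp.
- exists w, rest; split; [easy|split; [easy|split; [now rewrite Hp|]]].
  intros i; split; intros Hi.
  + apply (Permutation_in _ (Permutation_sym Hp)) in Hi; destruct Hi; auto.
  + apply (Permutation_in _ Hp); destruct Hi as [->|]; simpl; auto.
Qed.

Lemma bcbo_go_nil sl : bcbo_go S b (B S) sl [] = [].
Proof. now destruct sl. Qed.

Lemma offer_ge0 s i : (i < n S)%nat -> (1 <= s <= k S)%nat -> 0 <= offer S b (B S) s i.
Proof.
intros Hi Hs.
pose proof (theta_pos_decreasing S wf s s ltac:(lia) ltac:(lia) ltac:(lia)).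
apply Rmin_glb; [auto|].
destruct wf as (_ & _ & _ & _ & _ & HB & _).
specialize (HB i Hi).
apply Rlt_le, Rdiv_lt_0_compat; lra.
Qed.

Lemma bcbo_go_entry sl : (forall s, In s sl -> (1 <= s <= k S)%nat) ->
  forall rem, NoDup rem -> (forall i, In i rem -> (i < n S)%nat) ->
  forall i s p, In (i, s, p) (bcbo_go S b (B S) sl rem) ->
  In i rem /\ In s sl /\ 0 <= p <= b i.
Proof.
induction sl as [|h sl IH]; intros Hsl rem Hd Hn i s p; [easy|].
destruct rem as [|x rem']; [now rewrite bcbo_go_nil|].
destruct (bcbo_go_cases h sl _ Hd ltac:(discriminate)) as (w & rest & -> & Hs & Hd' & Hin).
inversion_clear Hs as [|? ? Hs' Hw]; inversion_clear Hd' as [|? ? Hw' Hd''].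
assert (Hn' : forall i, In i rest -> (i < n S)%nat) by (intros; apply Hn, Hin; auto).
intros [[= <- <- <-]|H].
- rewrite Hin; split; [auto|split; [now left|]].
  assert (Hh : (1 <= h <= k S)%nat) by (apply Hsl; now left).
  pose proof (Rmin_l (b w) (B S w / theta S h)).
  enough (0 <= head_value (offer S b (B S) h) rest <= offer S b (B S) h w)
    by (unfold offer in *; lra).
  apply head_value_bounds; auto.
  + apply offer_ge0; auto; apply Hn, Hin; auto.
  + intros; apply offer_ge0; auto.
- apply IH in H; auto.
  + rewrite Hin; simpl; tauto.
  + intros; apply Hsl; now right.
Qed.

Lemma bcbo_go_NoDup sl : (forall s, In s sl -> (1 <= s <= k S)%nat) -> NoDup sl ->
  forall rem, NoDup rem -> (forall i, In i rem -> (i < n S)%nat) ->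
  NoDup (map (fun e => fst (fst e)) (bcbo_go S b (B S) sl rem)) /\
  NoDup (map (fun e => snd (fst e)) (bcbo_go S b (B S) sl rem)).
Proof.
intros Hsl Hdsl; revert Hsl; induction Hdsl as [|h sl Hh Hdsl IH];
  intros Hsl rem Hd Hn; [split; constructor|].
destruct rem as [|x rem']; [rewrite bcbo_go_nil; split; constructor|].
destruct (bcbo_go_cases h sl _ Hd ltac:(discriminate)) as (w & rest & -> & Hs & Hd' & Hin).
inversion_clear Hd' as [|? ? Hw' Hd''].
assert (Hn' : forall i, In i rest -> (i < n S)%nat) by (intros; apply Hn, Hin; auto).
assert (Hsl' : forall s, In s sl -> (1 <= s <= k S)%nat) by (intros; apply Hsl; now right).
specialize (IH Hsl' rest Hd'' Hn').
simpl; split; constructor; try apply IH; rewrite in_map_iff;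
  intros [[[i s] p] [Heq H]]; simpl in Heq; subst;
  apply bcbo_go_entry in H; auto; tauto.
Qed.

(** As long as [i] has not won, his offer is the uncapped [b i]. The winner of [s] then offers at
    least [b i], which bounds from below both his bid and his budget divided by the rate. *)
Lemma bcbo_go_block sl : StronglySorted lt sl ->
  (forall s, In s sl -> (1 <= s <= k S)%nat) ->
  forall rem, NoDup rem -> forall i s, In i rem -> In s sl ->
  (forall s, In s sl -> theta S s * b i <= B S i) ->
  (exists s' p, In (i, s', p) (bcbo_go S b (B S) sl rem) /\ (s' <= s)%nat) \/
  (exists w p, In (w, s, p) (bcbo_go S b (B S) sl rem) /\
     w <> i /\ b i <= b w /\ theta S s * b i <= B S w).
Proof.
induction 1 as [|h sl Hsort IH Hh]; intros Hsl rem Hd i s Hi Hs Haff; [easy|].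
assert (Hne : rem <> []) by now intros ->.
destruct (bcbo_go_cases h sl _ Hd Hne) as (w & rest & -> & Hss & Hd' & Hin).
inversion_clear Hss as [|? ? Hss' Hw]; inversion_clear Hd' as [|? ? Hw' Hd''].
apply Hin in Hi; destruct Hi as [->|Hi].
- left; exists h, (head_value (offer S b (B S) h) rest); split; [now left|].
  destruct Hs as [<-|Hs]; [lia|].
  rewrite Forall_forall in Hh; specialize (Hh s Hs); lia.
- destruct Hs as [<-|Hs].
  + right; exists w, (head_value (offer S b (B S) h) rest).
    split; [now left|split; [now intros ->|]].
    rewrite Forall_forall in Hw; specialize (Hw i Hi).
    specialize (Haff h (or_introl eq_refl)); specialize (Hsl h (or_introl eq_refl)).
    pose proof (theta_pos_decreasing S wf h h ltac:(lia) ltac:(lia) ltac:(lia)) as Hth.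
    assert (Hcap : b i <= B S i / theta S h) by (apply le_div_r; lra).
    unfold offer in Hw; rewrite (Rmin_left (b i)) in Hw by exact Hcap.
    split; [eapply Rle_trans; [exact Hw|apply Rmin_l]|].
    assert (Hcap' : b i <= B S w / theta S h)
      by (eapply Rle_trans; [exact Hw|apply Rmin_r]).
    apply le_div_r in Hcap'; lra.
  + destruct (IH (fun s Hs => Hsl s (or_intror Hs)) rest Hd'' i s Hi Hs
                 (fun s Hs => Haff s (or_intror Hs)))
      as [(s' & p & H1 & H2)|(w' & p & H1 & H2)].
    * left; exists s', p; simpl; auto.
    * right; exists w', p; simpl; auto.
Qed.

(** The winner of the later slot [u] was still present when [s] was awarded, so the second largest
    offer at [s] is at least his. *)
Lemma bcbo_go_price sl : StronglySorted lt sl ->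
  (forall s, In s sl -> (1 <= s <= k S)%nat) ->
  forall rem, NoDup rem -> (forall i, In i rem -> (i < n S)%nat) ->
  forall i s p q u r,
  In (i, s, p) (bcbo_go S b (B S) sl rem) -> In (q, u, r) (bcbo_go S b (B S) sl rem) ->
  (s < u)%nat -> offer S b (B S) s q <= p.
Proof.
induction 1 as [|h sl Hsort IH Hh]; intros Hsl rem Hd Hn i s p q u r; [easy|].
destruct rem as [|x rem']; [now rewrite bcbo_go_nil|].
destruct (bcbo_go_cases h sl _ Hd ltac:(discriminate)) as (w & rest & -> & Hs & Hd' & Hin).
inversion_clear Hs as [|? ? Hs' Hw]; inversion_clear Hd' as [|? ? Hw' Hd''].
assert (Hn' : forall i, In i rest -> (i < n S)%nat) by (intros; apply Hn, Hin; auto).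
assert (Hsl' : forall s, In s sl -> (1 <= s <= k S)%nat) by (intros; apply Hsl; now right).
intros [[= <- <- <-]|H1] [[= <- <- <-]|H2] Hsu.
- lia.
- apply bcbo_go_entry in H2; auto; now apply head_value_ge.
- apply bcbo_go_entry in H1; auto.
  rewrite Forall_forall in Hh; specialize (Hh s ltac:(tauto)); lia.
- eauto.
Qed.

Lemma seq_sorted_lt a m : StronglySorted lt (seq a m).
Proof.
revert a; induction m as [|m IH]; intros a; simpl; constructor; auto.
rewrite Forall_forall; intros x Hx; apply in_seq in Hx; lia.
Qed.

Lemma bcbo_regular : regular S b (BCBO S b (B S)).
Proof.
unfold BCBO.
assert (Hsl : forall s, In s (slots S) <-> (1 <= s <= k S)%nat)
  by (intros s; unfold slots; rewrite in_seq; lia).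
assert (Hsl' : forall s, In s (slots S) -> (1 <= s <= k S)%nat) by apply Hsl.
assert (Hn : forall i, In i (players S) -> (i < n S)%nat) by apply in_players.
assert (Hd : NoDup (players S)) by apply seq_NoDup.
assert (Hsort : StronglySorted lt (slots S)) by apply seq_sorted_lt.
destruct (bcbo_go_NoDup (slots S) Hsl' (seq_NoDup _ _) _ Hd Hn) as [H1 H2].
constructor; [exact H1|exact H2|..].
- intros i s p H; apply bcbo_go_entry in H; auto.
  rewrite in_players, Hsl in H; tauto.
- intros i s Hi Hs Ha; apply bcbo_go_block; auto.
  + now apply in_players.
  + now apply Hsl.
  + intros s' Hs'; apply Hsl in Hs'.
    pose proof (theta_pos_decreasing S wf 1 s' ltac:(lia) ltac:(lia) ltac:(lia)).
    specialize (b_ge0 i Hi); nra.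
- intros i s p q u r H3 H4 Hsu; left.
  exact (bcbo_go_price _ Hsort Hsl' _ Hd Hn _ _ _ _ _ _ H3 H4 Hsu).
Qed.

End Mechanisms.

(** * Guaranteed slots, and utilities of assigned players *)

Lemma NoDup_map_inj {X Y} (f : X -> Y) l x y :
  NoDup (map f l) -> In x l -> In y l -> f x = f y -> x = y.
Proof.
induction l as [|a l IH]; simpl; [easy|].
intros Hd; inversion_clear Hd as [|? ? Ha Hl].
intros [<-|Hx] [<-|Hy] E; auto; destruct Ha.
- rewrite E; now apply in_map.
- rewrite <- E; now apply in_map.
Qed.

(** Otherwise each slot [s <= j] is held by another player bidding at least [b i], who can afford
    this at slot [j] since [theta S j <= theta S s]. These [j] holders are distinct and all lie in
    [F]. *)
Lemma guarantee S b o i j F :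
  well_formed S -> regular S b o -> (i < n S)%nat -> (1 <= j <= k S)%nat ->
  0 <= b i -> theta S 1 * b i <= B S i ->
  (forall w, (w < n S)%nat -> w <> i -> b i <= b w -> theta S j * b i <= B S w -> In w F) ->
  (length F < j)%nat ->
  exists s p, In (i, s, p) o /\ (s <= j)%nat.
Proof.
intros wf reg Hi Hj Hb Haff HF Hlen.
apply NNPP; intros Hno.
enough (j <= length F)%nat by lia.
rewrite <- (length_seq j 1).
apply (pigeonhole (fun s w => exists p, In (w, s, p) o)).
- apply seq_NoDup.
- intros s Hs; apply in_seq in Hs.
  destruct (reg_block _ _ _ reg i s Hi ltac:(lia) Haff)
    as [(s' & p & H1 & H2)|(w & p & H1 & H2 & H3 & H4)].
  + destruct Hno; exists s', p; split; [easy|lia].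
  + exists w; split; [|now exists p].
    apply HF; auto; [now apply (reg_entry _ _ _ reg) in H1|].
    pose proof (theta_pos_decreasing S wf s j ltac:(lia) ltac:(lia) ltac:(lia)); nra.
- intros s s' w [p H] [p' H'].
  pose proof (NoDup_map_inj _ _ _ _ (reg_players _ _ _ reg) H H' eq_refl); congruence.
Qed.

Lemma utility_entry S b o i s p : regular S b o -> In (i, s, p) o ->
  utility S o i =
    if Rle_dec (theta S s * p) (B S i) then Fin (theta S s * (v S i - p)) else NegInf.
Proof.
intros reg H; unfold utility.
destruct (find _ o) as [[[i' s'] p']|] eqn:E.
- apply find_some in E; destruct E as [H' E]; apply Nat.eqb_eq in E; simpl in E; subst i'.
  pose proof (NoDup_map_inj _ _ _ _ (reg_players _ _ _ reg) H H' eq_refl) as [= <- <-].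
  reflexivity.
- apply find_none with (x := (i, s, p)) in E; auto.
  simpl in E; rewrite Nat.eqb_refl in E; discriminate.
Qed.

(** * Equilibria of an arbitrary regular mechanism *)

Section Equilibrium.

Variables (M : mechanism) (S : setting) (b : nat -> R).
Hypotheses (wf : well_formed S)
  (M_regular : forall b, (forall i, (i < n S)%nat -> 0 <= b i) ->
                         regular S b (M S b (B S)))
  (NE : is_NE M S b).

Lemma NE_regular : regular S b (M S b (B S)).
Proof. apply M_regular, NE. Qed.

(** Bidding [beta] wins some slot [s <= j] at a price [p <= beta]. The payment is at most
    [theta S 1 * beta], hence within budget, and the better slot at a lower price is worth at least
    slot [j] at price [beta], as [beta <= v S i]. *)
Lemma NE_deviation i j beta F :
  (i < n S)%nat -> (1 <= j <= k S)%nat -> 0 <= beta <= v S i ->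
  theta S 1 * beta <= B S i ->
  (forall w, (w < n S)%nat -> w <> i -> beta <= b w -> theta S j * beta <= B S w -> In w F) ->
  (length F < j)%nat ->
  ~ eR_lt (utility S (M S b (B S)) i) (Fin (theta S j * (v S i - beta))).
Proof.
intros Hi Hj Hbeta Haff HF Hlen Hlt.
destruct NE as [b_ge0 Hne].
apply (Hne i Hi beta ltac:(lra)).
assert (reg : regular S (update b i beta) (M S (update b i beta) (B S))).
{ apply M_regular; intros w Hw; unfold update; destruct (Nat.eqb w i); [lra|auto]. }
assert (Ei : update b i beta i = beta) by (unfold update; now rewrite Nat.eqb_refl).
destruct (guarantee S (update b i beta) _ i j F wf reg Hi Hj) as (s & p & H & Hs);
  rewrite ?Ei; auto; [lra|..].
{ intros w Hw Hwi; unfold update; rewrite (proj2 (Nat.eqb_neq w i) Hwi); auto. }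
destruct (reg_entry _ _ _ reg _ _ _ H) as (_ & Hs' & Hp); rewrite Ei in Hp.
rewrite (utility_entry _ _ _ _ _ _ reg H).
pose proof (theta_pos_decreasing S wf 1 s ltac:(lia) ltac:(lia) ltac:(lia)).
pose proof (theta_pos_decreasing S wf s j ltac:(lia) ltac:(lia) ltac:(lia)).
destruct (Rle_dec _ _) as [_|Hno]; [|destruct Hno; nra].
assert (theta S j * (v S i - beta) <= theta S s * (v S i - p)) by nra.
destruct (utility S (M S b (B S)) i); simpl in *; [lra|easy].
Qed.

Lemma NE_entry_ge i s p j beta F : In (i, s, p) (M S b (B S)) ->
  (1 <= j <= k S)%nat -> 0 <= beta <= v S i -> theta S 1 * beta <= B S i ->
  (forall w, (w < n S)%nat -> w <> i -> beta <= b w -> theta S j * beta <= B S w -> In w F) ->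
  (length F < j)%nat ->
  theta S j * (v S i - beta) <= theta S s * (v S i - p).
Proof.
intros H Hj Hbeta Haff HF Hlen.
destruct (reg_entry _ _ _ NE_regular _ _ _ H) as (Hi & _).
pose proof (NE_deviation i j beta F Hi Hj Hbeta Haff HF Hlen) as Hd.
rewrite (utility_entry _ _ _ _ _ _ NE_regular H) in Hd.
destruct (Rle_dec _ _); simpl in Hd; [lra|tauto].
Qed.

Hypothesis kn : k S = n S.

Lemma NE_floor i : (i < n S)%nat ->
  ~ eR_lt (utility S (M S b (B S)) i) (Fin (theta S (k S) * v S i)).
Proof.
intros Hi.
assert (Hv : 0 <= v S i) by now apply wf.
assert (HB : 0 < B S i) by now apply wf.
(* The deviation is a bid of 0: all the other players together cannot fill the [k = n] slots. *)
replace (v S i) with (v S i - 0) by ring.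
apply NE_deviation with (F := remove Nat.eq_dec i (players S)); try lra; try lia; auto.
- intros w Hw Hwi _ _; apply in_in_remove; auto; now apply in_players.
- rewrite kn, <- (length_seq (n S) 0).
  now apply remove_length_lt, in_players.
Qed.

(** An unassigned player has utility 0, below his positive floor. *)
Lemma NE_assigned i : (i < n S)%nat -> 0 < v S i ->
  exists s p, In (i, s, p) (M S b (B S)).
Proof.
intros Hi Hv.
pose proof (NE_floor i Hi) as Hfl; unfold utility in Hfl.
destruct (find _ _) as [[[i' s] p]|] eqn:E.
- apply find_some in E; destruct E as [H E]; apply Nat.eqb_eq in E; simpl in E; subst i'; eauto.
- destruct Hfl; simpl.
  pose proof (theta_pos_decreasing S wf (k S) (k S) ltac:(lia) ltac:(lia) ltac:(lia)); nra.
Qed.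

Lemma NE_entry i s p : In (i, s, p) (M S b (B S)) ->
  theta S s * p <= B S i /\ theta S (k S) * v S i <= theta S s * (v S i - p).
Proof.
intros H.
destruct (reg_entry _ _ _ NE_regular _ _ _ H) as (Hi & _).
pose proof (NE_floor i Hi) as Hfl.
rewrite (utility_entry _ _ _ _ _ _ NE_regular H) in Hfl.
destruct (Rle_dec _ _); simpl in Hfl; [lra|tauto].
Qed.

(** All players are assigned, to distinct slots, and there are as many slots as players. *)
Lemma NE_slot_held s : (forall i, (i < n S)%nat -> 0 < v S i) -> (1 <= s <= k S)%nat ->
  exists i p, In (i, s, p) (M S b (B S)).
Proof.
intros Hv Hs.
pose proof NE_regular as reg.
enough (Hin : In s (map (fun e => snd (fst e)) (M S b (B S)))).
{ apply in_map_iff in Hin; destruct Hin as [[[i s'] p] [E H]]; simpl in E; subst; eauto. }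
assert (Hincl : incl (slots S) (map (fun e => snd (fst e)) (M S b (B S)))).
{ apply NoDup_length_incl; [apply reg| |].
  - unfold slots; rewrite length_seq, length_map, kn.
    rewrite <- (length_seq (n S) 0).
    rewrite <- (length_map (fun e => fst (fst e)) (M S b (B S))).
    apply NoDup_incl_length; [apply seq_NoDup|].
    intros i Hi; apply in_players in Hi.
    destruct (NE_assigned i Hi (Hv i Hi)) as (s' & p & H).
    apply in_map_iff; now exists (i, s', p).
  - intros s' Hs'; apply in_map_iff in Hs'; destruct Hs' as [[[i s''] p] [<- H]].
    apply (reg_entry _ _ _ reg) in H; unfold slots; rewrite in_seq; simpl; lia. }
apply Hincl; unfold slots; rewrite in_seq; lia.
Qed.

End Equilibrium.

(** * The five-slot setting *)

(** Rich budgets exceed [70 * 10]. Poor budgets cover [70 * 6 = 420], but neither [60 * 8 = 480] nor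
    [60 * (15 / 2) = 450]. The rates 21 and 20 are so close that a slightly lower price outweighs
    moving from slot 3 to slot 4. The default 10 is the rate of slot 5. *)
Definition ex_setting : setting := {|
  k := 5;
  n := 5;
  theta := fun j => match j with 1 => 70 | 2 => 60 | 3 => 21 | 4 => 20 | _ => 10 end;
  v := fun i => if (i <? 3)%nat then 10 else 12;
  B := fun i => match i with 0 => 800 | 1 => 900 | 2 => 1000 | 3 => 430 | _ => 440 end;
  prio := fun i => i
|}.

Lemma ex_well_formed : well_formed ex_setting.
Proof.
repeat split; simpl; try lia; try lra.
- intros [|[|[|[|[|j]]]]]; intros; try lia; lra.
- intros i _; destruct (i <? 3)%nat; lra.
- intros [|[|[|[|i]]]] _; lra.
- intros [|[|[|[|[|i]]]]] [|[|[|[|[|j]]]]]; intros; try lia; lra.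
Qed.

Lemma ex_rich i : (i < 3)%nat -> v ex_setting i = 10 /\ 800 <= B ex_setting i.
Proof. intros Hi; destruct i as [|[|[|i]]]; simpl; try lia; lra. Qed.

Lemma ex_poor i : (3 <= i < 5)%nat -> v ex_setting i = 12 /\ 430 <= B ex_setting i <= 440.
Proof. intros Hi; destruct i as [|[|[|[|[|i]]]]]; simpl; try lia; lra. Qed.

Ltac ex_theta :=
  change (theta ex_setting 1) with 70 in *; change (theta ex_setting 2) with 60 in *;
  change (theta ex_setting 3) with 21 in *; change (theta ex_setting 4) with 20 in *;
  change (theta ex_setting 5) with 10 in *.

(** * No equilibrium in the five-slot setting *)

Section NoEquilibrium.

Variables (M : mechanism) (b : nat -> R).
Hypotheses
  (M_regular : forall b, (forall i, (i < n ex_setting)%nat -> 0 <= b i) ->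
                         regular ex_setting b (M ex_setting b (B ex_setting)))
  (NE : is_NE M ex_setting b).

Let o := M ex_setting b (B ex_setting).

Lemma ex_regular : regular ex_setting b o.
Proof. apply M_regular, NE. Qed.

Lemma ex_entry i s p : In (i, s, p) o ->
  (i < 5)%nat /\ 0 <= p /\ theta ex_setting s * p <= B ex_setting i /\
  10 * v ex_setting i <= theta ex_setting s * (v ex_setting i - p).
Proof.
intros H.
destruct (NE_entry M _ b ex_well_formed M_regular NE eq_refl i s p H).
destruct (reg_entry _ _ _ ex_regular _ _ _ H) as (Hi & _ & Hp & _); auto.
Qed.

Lemma ex_entry_ge i s p j beta F : In (i, s, p) o ->
  (1 <= j <= 5)%nat -> 0 <= beta <= v ex_setting i -> 70 * beta <= B ex_setting i ->
  (forall w, (w < 5)%nat -> w <> i -> beta <= b w ->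
             theta ex_setting j * beta <= B ex_setting w -> In w F) ->
  (length F < j)%nat ->
  theta ex_setting j * (v ex_setting i - beta) <= theta ex_setting s * (v ex_setting i - p).
Proof. exact (NE_entry_ge M _ b ex_well_formed M_regular NE i s p j beta F). Qed.

Lemma ex_slot_held s : (1 <= s <= 5)%nat -> exists i p, In (i, s, p) o.
Proof.
intros Hs; apply (NE_slot_held M _ b ex_well_formed M_regular NE eq_refl); auto.
intros i _; simpl; destruct (i <? 3)%nat; lra.
Qed.

Lemma ex_holders_neq i s p i' s' p' : In (i, s, p) o -> In (i', s', p') o ->
  s <> s' -> i <> i'.
Proof.
intros H H' Hs <-.
now pose proof (NoDup_map_inj _ _ _ _ (reg_players _ _ _ ex_regular) H H' eq_refl) as [= <- <-].
Qed.

Lemma ex_price i s p q t r beta : In (i, s, p) o -> In (q, t, r) o -> (s < t)%nat ->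
  beta <= b q -> theta ex_setting s * beta <= B ex_setting q -> beta <= p \/ b i <= r.
Proof.
intros H H' Hst Hb Haff.
destruct (reg_price _ _ _ ex_regular _ _ _ _ _ _ H H' Hst) as [Hp|]; auto.
left; eapply Rle_trans; [|exact Hp].
apply Rmin_glb; [easy|].
destruct (reg_entry _ _ _ ex_regular _ _ _ H) as (_ & Hs & _).
pose proof (theta_pos_decreasing _ ex_well_formed s s ltac:(lia) ltac:(lia) ltac:(lia)).
apply le_div_r; lra.
Qed.

Lemma two_removed_length i j : (i < 5)%nat -> (j < 5)%nat -> i <> j ->
  length (remove Nat.eq_dec i (remove Nat.eq_dec j (seq 0 5))) = 3%nat.
Proof.
intros Hi Hj Hij.
destruct i as [|[|[|[|[|i]]]]]; try lia;
  destruct j as [|[|[|[|[|j]]]]]; try lia; reflexivity.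
Qed.

(** Without [i] and the low bidder [q], three possible blockers remain, too few to fill slots 1 to
    4. *)
Lemma ex_slot4_ge i s p q beta : In (i, s, p) o -> (q < 5)%nat -> q <> i ->
  b q < beta -> 0 <= beta <= v ex_setting i -> 70 * beta <= B ex_setting i ->
  20 * (v ex_setting i - beta) <= theta ex_setting s * (v ex_setting i - p).
Proof.
intros H Hq Hqi Hb Hbeta Haff.
destruct (ex_entry _ _ _ H) as (Hi & _).
apply (ex_entry_ge i s p 4 beta (remove Nat.eq_dec i (remove Nat.eq_dec q (seq 0 5))));
  [exact H|lia|exact Hbeta|exact Haff| |rewrite two_removed_length; auto].
intros w Hw Hwi Hbw _.
apply in_in_remove; auto; apply in_in_remove; [intros ->; lra|apply in_seq; lia].
Qed.

Lemma ex_slot5_free z p : In (z, 5%nat, p) o -> p = 0.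
Proof. intros H; destruct (ex_entry _ _ _ H) as (_ & H1 & _ & H2); ex_theta; lra. Qed.

Lemma ex_slot5_not_poor z p : In (z, 5%nat, p) o -> (z < 3)%nat.
Proof.
intros Hz.
destruct (ex_entry _ _ _ Hz) as (Hz5 & _).
pose proof (ex_slot5_free _ _ Hz) as ->.
destruct (Nat.lt_ge_cases z 3) as [|Hz3]; auto; exfalso.
destruct (ex_poor z ltac:(lia)) as [Hvz HBz].
(* For a poor player slot 4 at price 6 breaks even with slot 5 for free: [20 * (12 - 6) = 10 * 12].
   A bid midway between [b q] and 6 would be strictly better; [Rmax] keeps it nonnegative. *)
assert (Hb : forall q, (q < 5)%nat -> q <> z -> 6 <= b q).
{ intros q Hq Hqz; apply Rnot_lt_le; intros Hlt.
  pose proof (Rmax_l (b q) 0); pose proof (Rmax_r (b q) 0).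
  assert (Rmax (b q) 0 < 6) by (apply Rmax_lub_lt; lra).
  pose proof (ex_slot4_ge _ _ _ q ((Rmax (b q) 0 + 6) / 2) Hz Hq Hqz
    ltac:(lra) ltac:(lra) ltac:(lra)) as Hd.
  rewrite Hvz in Hd; ex_theta; lra. }
assert (Hkey : forall y s r y' s' r', In (y, s, r) o -> In (y', s', r') o ->
  y <> y' -> (s = 3 \/ s = 4)%nat -> (s' = 3 \/ s' = 4)%nat -> 6 <= r -> False).
{ intros y s r y' s' r' Hy Hy' Hyy Hs Hs' Hr.
  destruct (ex_entry _ _ _ Hy) as (Hy5 & _ & _ & Huy).
  destruct (ex_entry _ _ _ Hy') as (Hy5' & _ & _ & Huy').
  assert (y <> z) by (apply (ex_holders_neq _ _ _ _ _ _ Hy Hz); lia).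
  assert (y' <> z) by (apply (ex_holders_neq _ _ _ _ _ _ Hy' Hz); lia).
  (* Paying 6 leaves a rich player at most [21 * (10 - 6) = 84], under his floor 100, so [y] is
     poor. *)
  destruct (Nat.lt_ge_cases y 3) as [Hy3|Hy3].
  { destruct (ex_rich y Hy3) as [Hv _]; rewrite Hv in Huy.
    destruct Hs as [-> | ->]; ex_theta; lra. }
  destruct (ex_poor y ltac:(lia)) as [Hv HB].
  (* [y] and [z] are the two poor players, so [y'] is rich. *)
  destruct (ex_rich y' ltac:(lia)) as [Hv' HB'].
  (* Otherwise [y'] would pay at least [11 / 2], since [z] pays 0, and would keep at most
     [21 * (9 / 2) = 94.5 < 100]. *)
  assert (Hbz : b z < 11 / 2).
  { apply Rnot_le_lt; intros Hbz.
    destruct (ex_price _ _ _ _ _ _ (11 / 2) Hy' Hz) as [Hp|Hp]; try easy; try lia.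
    - destruct Hs' as [-> | ->]; ex_theta; lra.
    - rewrite Hv' in Huy'; destruct Hs' as [-> | ->]; ex_theta; lra.
    - specialize (Hb y' Hy5' ltac:(auto)); lra. }
  (* The deviation yields [20 * (12 - 11 / 2) = 130], more than [21 * (12 - 6) = 126]. *)
  pose proof (ex_slot4_ge _ _ _ z (11 / 2) Hy Hz5 ltac:(auto) Hbz
    ltac:(lra) ltac:(lra)) as Hd.
  rewrite Hv in Hd; destruct Hs as [-> | ->]; ex_theta; lra. }
destruct (ex_slot_held 3 ltac:(lia)) as (i3 & p3 & H3).
destruct (ex_slot_held 4 ltac:(lia)) as (i4 & p4 & H4).
assert (Hne : i3 <> i4) by (apply (ex_holders_neq _ _ _ _ _ _ H3 H4); lia).
assert (i3 <> z) by (apply (ex_holders_neq _ _ _ _ _ _ H3 Hz); lia).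
assert (i4 <> z) by (apply (ex_holders_neq _ _ _ _ _ _ H4 Hz); lia).
destruct (ex_entry _ _ _ H3) as (H35 & _); destruct (ex_entry _ _ _ H4) as (H45 & _).
destruct (ex_price _ _ _ _ _ _ 6 H3 H4) as [Hp|Hp]; try lia; auto.
- destruct (Nat.lt_ge_cases i4 3) as [Hi|Hi];
    [destruct (ex_rich i4 Hi)|destruct (ex_poor i4 ltac:(lia))]; ex_theta; lra.
- exact (Hkey _ _ _ _ _ _ H3 H4 Hne ltac:(auto) ltac:(auto) Hp).
- specialize (Hb i3 H35 ltac:(auto)).
  exact (Hkey _ _ _ _ _ _ H4 H3 ltac:(auto) ltac:(auto) ltac:(auto) ltac:(lra)).
Qed.

Lemma ex_contradiction : False.
Proof.
destruct (ex_slot_held 5 ltac:(lia)) as (z & p & Hz).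
pose proof (ex_slot5_not_poor _ _ Hz) as Hz3.
pose proof (ex_slot5_free _ _ Hz) as ->.
destruct (ex_rich z Hz3) as [Hvz HBz].
(* The break-even price of slot 4 for a rich player: [20 * (10 - 5) = 10 * 10]. *)
assert (Hb5 : forall q, (q < 5)%nat -> q <> z -> 5 <= b q).
{ intros q Hq Hqz; apply Rnot_lt_le; intros Hlt.
  pose proof (Rmax_l (b q) 0); pose proof (Rmax_r (b q) 0).
  assert (Rmax (b q) 0 < 5) by (apply Rmax_lub_lt; lra).
  pose proof (ex_slot4_ge _ _ _ q ((Rmax (b q) 0 + 5) / 2) Hz Hq Hqz
    ltac:(lra) ltac:(lra) ltac:(lra)) as Hd.
  rewrite Hvz in Hd; ex_theta; lra. }
assert (Hb8 : forall q, (q < 3)%nat -> q <> z -> 8 <= b q).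
{ intros q Hq Hqz; apply Rnot_lt_le; intros Hlt.
  (* The rich players 0, 1, 2 sum to 3, so [3 - z - q] is the third one. He alone could block [z] at
     slot 2, as the poor cannot pay 480; and [60 * (10 - 8) = 120] exceeds 100. *)
  assert (Hd := ex_entry_ge _ _ _ 2 8 [(3 - z - q)%nat] Hz).
  rewrite Hvz in Hd; ex_theta.
  enough (60 * (10 - 8) <= 10 * (10 - 0)) by lra.
  apply Hd; simpl length; try lia; try lra.
  intros w Hw Hwz Hbw HBw; left.
  destruct (Nat.lt_ge_cases w 3) as [Hw3|Hw3].
  - assert (w <> q) by (intros ->; lra); lia.
  - destruct (ex_poor w ltac:(lia)); ex_theta; lra. }
destruct (ex_slot_held 1 ltac:(lia)) as (i1 & p1 & H1).
destruct (ex_slot_held 2 ltac:(lia)) as (i2 & p2 & H2).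
destruct (ex_slot_held 3 ltac:(lia)) as (i3 & p3 & H3).
destruct (ex_slot_held 4 ltac:(lia)) as (i4 & p4 & H4).
assert (Hnz : forall i s r, In (i, s, r) o -> s <> 5%nat -> i <> z)
  by (intros i s r H; exact (ex_holders_neq _ _ _ _ _ _ H Hz)).
assert (Hbz : b z <= 6).
{ destruct (ex_entry _ _ _ H4) as (H45 & _ & _ & Hu).
  assert (Hp4 : p4 <= 6).
  { destruct (Nat.lt_ge_cases i4 3) as [Hi|Hi];
      [destruct (ex_rich i4 Hi) as [Hv _]|destruct (ex_poor i4 ltac:(lia)) as [Hv _]];
      rewrite Hv in Hu; ex_theta; lra. }
  apply Rnot_lt_le; intros Hlt.
  specialize (Hb5 i4 H45 (Hnz _ _ _ H4 ltac:(lia))).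
  (* Truncating at 7 makes the bid of [z] affordable at slot 4 while keeping it above 6. *)
  destruct (ex_price _ _ _ _ _ _ (Rmin (b z) 7) H4 Hz) as [Hp|Hp]; try lia.
  - apply Rmin_l.
  - pose proof (Rmin_r (b z) 7); ex_theta; lra.
  - assert (6 < Rmin (b z) 7) by (apply Rmin_glb_lt; lra); lra.
  - lra. }
(* 150 is slot 2 at price [15 / 2]. At that bid [z] is outbid and the poor cannot pay 450, so again
   a single rich blocker remains. *)
assert (Hrich : forall i s r, In (i, s, r) o -> (i < 3)%nat -> s <> 5%nat ->
                  150 <= theta ex_setting s * (10 - r)).
{ intros i s r H Hi Hs.
  specialize (Hnz _ _ _ H Hs).
  destruct (ex_rich i Hi) as [Hv HB].
  pose proof (ex_entry_ge _ _ _ 2 (15 / 2) [(3 - z - i)%nat] H) as Hd.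
  rewrite Hv in Hd.
  replace 150 with (theta ex_setting 2 * (10 - 15 / 2)) by (ex_theta; lra).
  apply Hd; ex_theta; simpl length; try lia; try lra.
  intros w Hw Hwi Hbw HBw; left.
  destruct (Nat.lt_ge_cases w 3) as [Hw3|Hw3].
  - assert (w <> z) by (intros ->; lra); lia.
  - destruct (ex_poor w ltac:(lia)); ex_theta; lra. }
assert (Htop : forall i s r, In (i, s, r) o -> (s = 1 \/ s = 2)%nat -> (i < 3)%nat).
{ intros i s r H Hs.
  destruct (ex_entry _ _ _ H) as (Hi5 & _ & Haff & _).
  destruct (Nat.lt_ge_cases i 3) as [|Hi3]; auto; exfalso.
  destruct (ex_poor i ltac:(lia)) as [_ HB].
  (* [z] is rich and [i] is poor, so at most one of slots 3 and 4 is held by a poor player. *)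
  assert (Hq : exists q t u, In (q, t, u) o /\ (q < 3)%nat /\ (t = 3 \/ t = 4)%nat).
  { assert (i <> i3) by (apply (ex_holders_neq _ _ _ _ _ _ H H3); lia).
    assert (i <> i4) by (apply (ex_holders_neq _ _ _ _ _ _ H H4); lia).
    assert (i3 <> i4) by (apply (ex_holders_neq _ _ _ _ _ _ H3 H4); lia).
    destruct (ex_entry _ _ _ H3) as (H35 & _); destruct (ex_entry _ _ _ H4) as (H45 & _).
    destruct (Nat.lt_ge_cases i3 3).
    - exists i3, 3%nat, p3; auto.
    - exists i4, 4%nat, p4; repeat split; auto; lia. }
  destruct Hq as (q & t & u & Hq & Hq3 & Ht).
  specialize (Hrich _ _ _ Hq Hq3 ltac:(lia)).
  destruct (ex_rich q Hq3) as [_ HBq].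
  (* Either [i] pays 8 per click, at least 480 in total and over his budget, or [q] pays at least
     [b i >= 5], whereas [Hrich] forces [u < 3]. *)
  destruct (ex_price _ _ _ _ _ _ 8 H Hq) as [Hp|Hp]; try lia.
  - apply Hb8; auto; apply (Hnz _ _ _ Hq); lia.
  - destruct Hs as [-> | ->]; ex_theta; lra.
  - destruct Hs as [-> | ->]; ex_theta; lra.
  - assert (5 <= b i) by (apply Hb5; auto; apply (Hnz _ _ _ H); lia).
    destruct Ht as [-> | ->]; ex_theta; lra. }
pose proof (Htop _ _ _ H1 ltac:(auto)) as Hr1.
pose proof (Htop _ _ _ H2 ltac:(auto)) as Hr2.
pose proof (Hrich _ _ _ H1 Hr1 ltac:(lia)) as Hu1; ex_theta.
pose proof (Hrich _ _ _ H2 Hr2 ltac:(lia)) as Hu2; ex_theta.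
specialize (Hb8 i1 Hr1 (Hnz _ _ _ H1 ltac:(lia))) as Hb1.
specialize (Hb8 i2 Hr2 (Hnz _ _ _ H2 ltac:(lia))) as Hb2.
destruct (ex_rich i2 Hr2) as [_ HB2].
(* One of the two holders pays at least 8 and so keeps at most [70 * (10 - 8) = 140 < 150]. *)
destruct (ex_price _ _ _ _ _ _ 8 H1 H2) as [Hp|Hp]; try lia; auto; ex_theta; lra.
Qed.

End NoEquilibrium.

Theorem theorem6 :
  exists S : setting, well_formed S /\
    (~ exists b, is_NE BCB S b) /\ (~ exists b, is_NE BCBO S b).
Proof.
exists ex_setting; split; [exact ex_well_formed|].
split; intros [b NE].
- apply (ex_contradiction BCB b); auto using bcb_regular, ex_well_formed.
- apply (ex_contradiction BCBO b); auto using bcbo_regular, ex_well_formed.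
Qed.
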